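(* The set $$\Big\{G:\mathbb{N}\to\mathbb{C}\ \Big|\ \forall a\in\mathbb{N}:\ \sum_{q=1}^{\infty}G(q)c_q(a)=0 \text{ and } \sum_{q=1}^{\infty}|G(q)c_q(a)|<\infty\Big\}$$ is infinite.
   Context: $\mathbb{N}=\{1,2,\dots\}$. For $q\in\mathbb{N}$ and $a\in\mathbb{Z}$, the Ramanujan sum is $c_q(a)=\sum_{1\le j\le q,\ (j,q)=1}\cos(2\pi j a/q)$. A series $\sum_{q=1}^\infty$ means $\lim_{x\to\infty}\sum_{q\le x}$ (the condition requires convergence for every $a$). *)

(* Defs.v *)
From HB Require Import structures.
From mathcomp Require Import all_boot all_order all_algebra.
From mathcomp Require Import all_classical all_reals all_analysis.
From mathcomp Require Import complex.

Set Implicit Arguments.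
Unset Strict Implicit.
Unset Printing Implicit Defensive.

Import Order.TTheory GRing.Theory Num.Theory.
Import numFieldNormedType.Exports.

Local Open Scope classical_set_scope.
Local Open Scope ring_scope.

(* A subtype is used because functions on all of [nat] would have a spurious
   free value at 0, making any set of them cut out by conditions at positive
   arguments infinite as soon as it is nonempty. *)
Definition posnat : Type := {n : nat | (0 < n)%N}.

(* The bijection n |-> n + 1 from {0, 1, ...} to {1, 2, ...}, which turns the
   library's series indexed from 0 into series indexed from 1. *)
Definition posnatS (n : nat) : posnat := exist _ n.+1 (ltn0Sn n).

Definition ramanujan_sum (R : realType) (q : posnat) (a : int) : R :=
  \sum_(1 <= j < (sval q).+1 | coprime j (sval q))
    cos (2 * pi * j%:R * a%:~R / (sval q)%:R).

Definition ramanujan_term (R : realType) (G : posnat -> R[i]) (a q : posnat) :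
    R[i] :=
  G q * (ramanujan_sum R q (sval a)%:Z)%:C%C.

(* [R[i]^o] is [R[i]] with the topology of the complex modulus; [series u n]
   is the sum of the [u k] for k < n, hence here the sum over 1 <= q <= n. *)
Definition ramanujan_null (R : realType) : set (posnat -> R[i]) :=
  [set G | forall a : posnat,
    (series (fun n => ramanujan_term G a (posnatS n)) : nat -> R[i]^o) @ \oo
      --> (0 : R[i]^o) /\
    (\sum_(0 <= n <oo)
       (ComplexField.Normc.normc (ramanujan_term G a (posnatS n)))%:E
     < +oo)%E].

(* Main.v *)
(** The solution set is a complex vector space, so one nonzero element suffices.
    The indicator function of the powers of 2 is one: sorting the residues modulo
    2^k by their gcd with 2^k gives
      c_1(a) + c_2(a) + c_4(a) + ... + c_{2^k}(a)
        = sum_{1 <= j <= 2^k} cos (2 pi j a / 2^k),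
    and the right-hand side vanishes as soon as a < 2^k. Hence also
    c_{2^k}(a) = 0 for large k, every series is a finite sum, and its value is 0. *)
Require Import Defs.
From mathcomp Require Import all_boot all_order all_algebra.
From mathcomp Require Import all_classical all_reals all_analysis.
From mathcomp Require Import complex zify ring.

Set Implicit Arguments.
Unset Strict Implicit.
Unset Printing Implicit Defensive.

Import Order.TTheory GRing.Theory Num.Theory.
Import numFieldNormedType.Exports.

Local Open Scope classical_set_scope.
Local Open Scope ring_scope.

Definition is_pow2 (q : nat) : bool := q == (2 ^ logn 2 q)%N.

Lemma is_pow2_expn k : is_pow2 (2 ^ k).
Proof. by rewrite /is_pow2 pfactorK. Qed.

Lemma is_pow2_between k q : (2 ^ k < q < 2 ^ k.+1)%N -> is_pow2 q = false.
Proof.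
move=> /andP[kq qk]; apply/negP => /eqP qE; move: kq qk.
by rewrite qE !ltn_exp2l//; lia.
Qed.

Lemma sum_odd_even (V : zmodType) (F : nat -> V) m :
  \sum_(1 <= j < m.*2.+1) F j =
  \sum_(1 <= j < m.*2.+1 | odd j) F j + \sum_(1 <= j < m.+1) F j.*2.
Proof.
elim: m => [|m IH]; first by rewrite !big_geq// addr0.
rewrite doubleS big_nat_recr//= big_nat_recr//= IH.
rewrite [in RHS]big_mkcond/= [\sum_(1 <= j < m.*2.+3) _]big_nat_recr//=.
rewrite [\sum_(1 <= j < m.*2.+2) _]big_nat_recr//= -big_mkcond/=.
rewrite [\sum_(1 <= j < m.+2) _]big_nat_recr//= odd_double/= doubleS.
by rewrite addr0 [in RHS]addrACA addrA.
Qed.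

Section RamanujanPow2.
Variable R : realType.
Implicit Types (a q k : nat) (c : R[i]).

Definition pow2_cos_sum a k : R :=
  \sum_(1 <= j < (2 ^ k).+1) cos (2 * pi * j%:R * a%:~R / (2 ^ k)%:R).

(** Telescoping: 2 cos(jx) sin(x/2) = sin((j + 1/2)x) - sin((j - 1/2)x). *)
Lemma sum_cos_mul_sin (x : R) n :
  (\sum_(1 <= j < n.+1) cos (j%:R * x)) * (2 * sin (x / 2)) =
  sin (n%:R * x + x / 2) - sin (x / 2).
Proof.
pose f j : R := sin ((j%:R - 1) * x + x / 2).
rewrite big_distrl/= (eq_bigr (fun j => f j.+1 - f j)); last first.
  move=> j _; rewrite /f.
  have -> : (j.+1%:R - 1) * x + x / 2 = j%:R * x + x / 2.
    by rewrite -natr1 addrK.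
  have -> : (j%:R - 1) * x + x / 2 = j%:R * x - x / 2 by field.
  by rewrite sinD sinB; ring.
by rewrite telescope_sumr// /f -natr1 addrK subrr mul0r add0r.
Qed.

(** With x = 2 pi a / 2^k, the bounds on a put x/2 strictly between 0 and pi, so 2 sin(x/2) can be
    cancelled; the telescoped sines agree because 2^k x = 2 pi a is a multiple of the period. *)
Lemma pow2_cos_sum_eq0 a k : (0 < a < 2 ^ k)%N -> pow2_cos_sum a k = 0.
Proof.
move=> /andP[a0 ak].
have N0 : (0 : R) < (2 ^ k)%:R by rewrite ltr0n expn_gt0.
pose x : R := 2 * pi * a%:R / (2 ^ k)%:R.
have s0 : 0 < sin (x / 2).
  have -> : x / 2 = pi * (a%:R / (2 ^ k)%:R).
    by rewrite /x; field; rewrite gt_eqF.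
  apply: sin_gt0_pi; rewrite mulr_gt0 ?pi_gt0 ?divr_gt0 ?(ltr0n, expn_gt0)//=.
  by rewrite gtr_pMr ?pi_gt0// ltr_pdivrMr// mul1r ltr_nat.
have : pow2_cos_sum a k * (2 * sin (x / 2)) = 0.
  rewrite /pow2_cos_sum (eq_bigr (fun j => cos (j%:R * x))); last first.
    by move=> j _; congr cos; rewrite /x; ring.
  rewrite sum_cos_mul_sin.
  have -> : (2 ^ k)%:R * x + x / 2 = x / 2 + pi *+ 2 *+ a.
    by rewrite /x; field; rewrite gt_eqF.
  by rewrite (periodicn (@sinD2pi R)) subrr.
by move/eqP; rewrite !mulf_eq0 pnatr_eq0 (gt_eqF s0)/= orbF => /eqP.
Qed.

Lemma pow2_cos_sum0 a : pow2_cos_sum a 0 = ramanujan_sum R (posnatS 0) a.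
Proof. by rewrite /pow2_cos_sum /ramanujan_sum [RHS]big_mkcond/= !big_nat1. Qed.

(** The odd j are those coprime to 2^(k+1) and give the Ramanujan sum; an even j = 2i gives the
    fraction i / 2^k of the previous level. *)
Lemma pow2_cos_sumS a k q : q.+1 = (2 ^ k.+1)%N ->
  pow2_cos_sum a k.+1 = ramanujan_sum R (posnatS q) a + pow2_cos_sum a k.
Proof.
move=> qE; rewrite /pow2_cos_sum /ramanujan_sum /= qE.
have -> : (2 ^ k.+1).+1 = (2 ^ k).*2.+1 by rewrite expnS mul2n.
rewrite sum_odd_even; congr (_ + _).
  by apply: eq_bigl => j; rewrite coprime_pexpr // coprimen2.
apply: eq_bigr => j _; congr cos.
have N0 : (2 ^ k)%:R != 0 :> R by rewrite pnatr_eq0 expn_eq0.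
by rewrite expnS natrM -muln2 natrM; field.
Qed.

(** It is the difference of two consecutive cosine sums, both of which vanish. *)
Lemma ramanujan_sum_pow2_eq0 a k q :
  (0 < a < 2 ^ k)%N -> q.+1 = (2 ^ k.+1)%N ->
  ramanujan_sum R (posnatS q) a = 0.
Proof.
move=> ak qE; have := pow2_cos_sumS a qE.
rewrite !pow2_cos_sum_eq0// ?addr0//.
by move: ak; rewrite expnS; lia.
Qed.

Definition pow2_term a q : R :=
  if is_pow2 q.+1 then ramanujan_sum R (posnatS q) a else 0.

Lemma sum_pow2_term a k :
  \sum_(0 <= q < 2 ^ k) pow2_term a q = pow2_cos_sum a k.
Proof.
elim: k => [|k IH]; first by rewrite big_nat1 pow2_cos_sum0.
have [q qE] : exists q, q.+1 = (2 ^ k.+1)%N.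
  by exists (2 ^ k.+1).-1; rewrite prednK ?expn_gt0.
have kq : (2 ^ k <= q)%N by move: qE (expn_gt0 2 k); rewrite expnS; lia.
rewrite (pow2_cos_sumS a qE) -IH -qE big_nat_recr//= addrC; congr (_ + _).
  by rewrite /pow2_term qE is_pow2_expn.
(* Index i stands for the modulus i+1, so the indices from 2^k up to q, exclusive, give moduli
   strictly between consecutive powers of 2. *)
rewrite (big_cat_nat (n := 2 ^ k))//= [X in _ + X]big_nat_cond.
rewrite [X in _ + X]big1 ?addr0// => i.
rewrite andbT => /andP[ki iq]; rewrite /pow2_term (@is_pow2_between k)//.
by rewrite -qE !ltnS ki iq.
Qed.

Lemma pow2_term_eq0 a k q :
  (0 < a < 2 ^ k)%N -> (2 ^ k <= q)%N -> pow2_term a q = 0.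
Proof.
move=> ak kq; rewrite /pow2_term; case: ifPn => // /eqP.
(* Exponent 0 would mean modulus 1, that is q = 0, against 2^k <= q. *)
case: (logn _ _) => [|l] qE; first by have := expn_gt0 2 k; lia.
have kl : (k <= l)%N.
  by rewrite -ltnS -(@ltn_exp2l 2)// -qE ltnS.
apply: (ramanujan_sum_pow2_eq0 _ qE); case/andP: ak => -> /=.
by move=> ak; rewrite (leq_trans ak)// leq_exp2l.
Qed.

(** The factor c is what makes a single solution into infinitely many. *)
Definition pow2_fun c (q : posnat) : R[i] := if is_pow2 (sval q) then c else 0.

Lemma ramanujan_term_pow2_fun c (a : posnat) q :
  ramanujan_term (pow2_fun c) a (posnatS q) = c * (pow2_term (sval a) q)%:C%C.
Proof.
rewrite /ramanujan_term /pow2_fun /pow2_term /=; case: ifP => // _.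
by rewrite rmorph0 mulr0 mul0r.
Qed.

Lemma pow2_fun_null c : ramanujan_null (pow2_fun c).
Proof.
move=> a; have ak : (0 < sval a < 2 ^ sval a)%N.
  by rewrite (svalP a) ltn_expl.
have term0 q : (2 ^ sval a <= q)%N ->
    ramanujan_term (pow2_fun c) a (posnatS q) = 0.
  by move=> aq; rewrite ramanujan_term_pow2_fun (pow2_term_eq0 ak aq) rmorph0 mulr0.
split.
  (* From index 2^a on, the partial sums are constant, equal to c times the cosine sum of level a,
     which vanishes since a < 2^a. *)
  apply: cvg_near_cst; exists (2 ^ sval a)%N => // n /= an.
  rewrite /series/= (big_cat_nat _ an)//= [X in _ + X]big_nat_cond.
  rewrite [X in _ + X]big1 ?addr0; last by move=> q /andP[/andP[+ _] _]; exact: term0.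
  rewrite (eq_bigr _ (fun q _ => ramanujan_term_pow2_fun c a q)) -big_distrr/=.
  by rewrite -rmorph_sum sum_pow2_term (pow2_cos_sum_eq0 ak) rmorph0 mulr0.
(* Absolute convergence: the tail is zero, leaving a finite sum of real moduli. *)
rewrite (nneseries_split _ (2 ^ sval a)); last first.
  by move=> q _; rewrite lee_fin; case: (ramanujan_term _ _ _) => x y; exact: sqrtr_ge0.
rewrite add0n eseries0 ?adde0; last first.
  by move=> q aq _; rewrite term0// ComplexField.Normc.normc0.
by rewrite sumEFin ltry.
Qed.

(** The value at 1 = 2^0 recovers c. *)
Lemma pow2_fun_inj : injective pow2_fun.
Proof. by move=> c d /(congr1 (@^~ (posnatS 0))). Qed.

End RamanujanPow2.

Theorem mainTheorem2 (R : realType) : infinite_set (@ramanujan_null R).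
Proof.
have inj : injective (fun n : nat => pow2_fun (n%:R : R[i])).
  by move=> m n /pow2_fun_inj/eqP; rewrite eqr_nat => /eqP.
apply: (@sub_infinite_set _ [set pow2_fun (n%:R : R[i]) | n in [set: nat]]).
  by move=> _ [n _ <-]; exact: pow2_fun_null.
rewrite (eq_finite_set (inj_card_eq _)); last by move=> m n _ _ /inj.
exact: infinite_nat.
Qed.
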